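(* The greedy algorithm (with suitable tie-breaking) has competitive ratio at least $\frac{2e^2}{e^2-1}\approx2.313$ for Maximum Bridge-Flow: for every $\rho<\frac{2e^2}{e^2-1}$ there is an instance of Maximum Bridge-Flow on which the greedy incremental solution is not $\rho$-competitive.
   Context: Maximum Bridge-Flow: a directed graph $G=(V,E)$ with capacities $u\colon E\to\mathbb R_{\ge0}\cup\{\infty\}$, vertices $s,t$, and a partition $(U,W)$ of $V$ with $s\in U$, $t\in W$ such that no edge goes from $W$ to $U$; let $C$ be the set of edges from $U$ to $W$; the ground set is $C$ and for $S\subseteq C$, $f(S)$ is the value of a maximum $s$-$t$-flow in $(V,E\setminus(C\setminus S))$. The greedy algorithm sets $\vec S_0=\emptyset$ and $\vec S_k=\vec S_{k-1}\cup\{s_k\}$ with $s_k\in\arg\max_{e\in C\setminus\vec S_{k-1}}f(\vec S_{k-1}\cup\{e\})$, ties broken in an arbitrary (here: adversarially chosen) way. With $f^\star_k=\max\{f(S):S\subseteq C,|S|=k\}$, the output is $\rho$-competitive if $f^\star_k/f(\vec S_k)\le\rho$ for all $k\in\{1,\dots,|C|\}$. *)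

(* Defs.v *)
From HB Require Import structures.
From mathcomp Require Import all_boot all_order all_algebra.
From mathcomp Require Import all_classical all_reals all_analysis.

Set Implicit Arguments.
Unset Strict Implicit.
Unset Printing Implicit Defensive.

Import Order.TTheory GRing.Theory Num.Theory.

Local Open Scope classical_set_scope.
Local Open Scope ring_scope.

(* An instance of Maximum Bridge-Flow on the vertex set [V].  The partition is
   (U, W) with U = [bf_left] and W = [~: bf_left]. *)
Record bridge_flow (R : realType) (V : finType) := BridgeFlow {
  bf_edges : {set V * V};
  bf_cap : V * V -> \bar R;
  bf_source : V;
  bf_sink : V;
  bf_left : {set V};
  bf_cap_ge0 : forall e, e \in bf_edges -> (0 <= bf_cap e)%E;
  bf_source_left : bf_source \in bf_left;
  bf_sink_right : bf_sink \in ~: bf_left;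
  bf_no_back : forall e, e \in bf_edges ->
    ~~ ((e.1 \in ~: bf_left) && (e.2 \in bf_left))
}.

Definition bridges (R : realType) (V : finType) (I : bridge_flow R V) :
    {set V * V} :=
  [set e in bf_edges I | (e.1 \in bf_left I) && (e.2 \in ~: bf_left I)]%SET.

(* Only the values of [phi] on the edge set [F] matter. *)
Definition is_flow (R : realType) (V : finType) (F : {set V * V})
    (u : V * V -> \bar R) (s t : V) (phi : V * V -> R) : Prop :=
  (forall e, e \in F -> 0 <= phi e /\ ((phi e)%:E <= u e)%E) /\
  (forall v, v != s -> v != t ->
    \sum_(e in F | e.2 == v) phi e = \sum_(e in F | e.1 == v) phi e).

Definition flow_value (R : realType) (V : finType) (F : {set V * V}) (s : V)
    (phi : V * V -> R) : R :=
  \sum_(e in F | e.1 == s) phi e - \sum_(e in F | e.2 == s) phi e.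

(* The supremum is a maximum whenever it is finite; it is +oo exactly when
   some s-t path in [F] has only edges of infinite capacity. *)
Definition max_flow (R : realType) (V : finType) (F : {set V * V})
    (u : V * V -> \bar R) (s t : V) : \bar R :=
  ereal_sup [set (flow_value F s phi)%:E | phi in [set phi | is_flow F u s t phi]].

Definition bf_value (R : realType) (V : finType) (I : bridge_flow R V)
    (S : {set V * V}) : \bar R :=
  max_flow (bf_edges I :\: (bridges I :\: S))
    (bf_cap I) (bf_source I) (bf_sink I).

(* Every maximizer is allowed at each step, so all ways of breaking ties are
   covered.  Only [S 0], ..., [S #|bridges I|] are constrained. *)
Definition greedy (R : realType) (V : finType) (I : bridge_flow R V)
    (S : nat -> {set V * V}) : Prop :=
  S 0%N = finset.set0 /\
  forall k : nat, (k < #|bridges I|)%N ->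
    exists2 x : V * V,
      x \in bridges I :\: S k /\
      (forall e, e \in bridges I :\: S k ->
        (bf_value I (e |: S k) <= bf_value I (x |: S k))%E)
      & S k.+1 = (x |: S k)%SET.

Definition bf_opt (R : realType) (V : finType) (I : bridge_flow R V) (k : nat) :
    \bar R :=
  \big[Order.max/-oo%E]_(S : {set V * V} | (S \subset bridges I) && (#|S| == k))
    bf_value I S.

(* Conventions of [\bar R]: c / 0 = +oo for c > 0, while 0 / 0 = +oo / +oo = 0,
   so a step where both values are 0, or both infinite, never violates the
   bound for rho >= 0. *)
Definition competitive (R : realType) (V : finType) (I : bridge_flow R V)
    (S : nat -> {set V * V}) (rho : R) : Prop :=
  forall k : nat, (1 <= k <= #|bridges I|)%N ->
    (bf_opt I k / bf_value I (S k) <= rho%:E)%E.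

(* Main.v *)
(* Write m for half the size of the optimum.  The "direct" bridges (a_i, t) and
   (s, b_i), for i < m, each lie on a path s -> a_i -> t or s -> b_i -> t of
   capacity 1, so that all of them together have value 2m.  In addition there
   are bridges (c_j, d_j), j < 2m, each of capacity q^j with q = 1 - 1/m: the
   vertex c_j draws q^j / m from every a_i, and d_j sends q^j / m to every b_i.
   A flow through (c_j, d_j) therefore uses up the direct bridges twice, at the
   a_i for one half of them and at the b_i for the other half.  Once
   (c_0, d_0), ..., (c_(n-1), d_(n-1)) are chosen, for a value of
   1 + q + ... + q^(n-1), every direct bridge and (c_n, d_n) all gain exactly
   q^n, so the greedy algorithm may choose the (c_j, d_j) in order.  After 2m
   steps its value is m (1 - q^(2m)), the optimum is at least 2m, and the ratio
   2 / (1 - (1 - 1/m)^(2m)) tends to 2 / (1 - e^-2). *)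
Require Import Defs.
From mathcomp Require Import all_boot all_order all_algebra.
From mathcomp Require Import all_classical all_reals all_analysis.
From mathcomp Require Import ring lra.
Import Order.TTheory GRing.Theory Num.Theory.
Local Open Scope ring_scope.

Set Implicit Arguments.
Unset Strict Implicit.
Unset Printing Implicit Defensive.

(** * Weak duality of flows and cuts *)

(** Summing the net outflow over [X] leaves only the contribution of [s], by conservation and
    [t \notin X]. Edges inside [X] cancel, and edges entering [X] can only lower the sum. *)
Lemma flow_le_cut (R : realType) (V : finType) (F : {set V * V})
    (u : V * V -> \bar R) (s t : V) (phi : V * V -> R) (X : {set V}) :
  is_flow F u s t phi -> s \in X -> t \notin X ->
  flow_value F s phi <= \sum_(e in F | (e.1 \in X) && (e.2 \notin X)) phi e.
Proof.
move=> [phiF cons] sX tX.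
have fiber (g : V * V -> V) : \sum_(v in X) \sum_(e in F | g e == v) phi e =
    \sum_(e in F | g e \in X) phi e.
  rewrite (partition_big g (mem X)) => [|e /andP[]//]; apply: eq_bigr => v vX.
  apply: eq_bigl => e; case: eqP => [->|]; rewrite ?andbT ?andbF //.
  by rewrite vX andbT.
have -> : flow_value F s phi =
    \sum_(e in F | e.1 \in X) phi e - \sum_(e in F | e.2 \in X) phi e.
  rewrite -!fiber -sumrB (bigD1 s) //= [X in _ + X]big1 ?addr0 // => v /andP[vX vs].
  by rewrite cons ?subrr //; apply: contraNneq tX => <-.
rewrite lerBlDr !big_mkcondr/= -big_split/=; apply: ler_sum => e /phiF[phi0 _].
by case: (e.1 \in X); case: (e.2 \in X); rewrite /= ?addr0 ?add0r.
Qed.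

Lemma max_flow_le_cut (R : realType) (V : finType) (F : {set V * V})
    (c : V * V -> R) (s t : V) (X : {set V}) : s \in X -> t \notin X ->
  (max_flow F (EFin \o c) s t <=
    (\sum_(e in F | (e.1 \in X) && (e.2 \notin X)) c e)%:E)%E.
Proof.
move=> sX tX; apply: ub_ereal_sup => _ [phi flow <-].
rewrite lee_fin (le_trans (flow_le_cut flow sX tX)) //.
by apply: ler_sum => e /andP[eF _]; case: flow => + _ => /(_ _ eF)[_]; rewrite lee_fin.
Qed.

(** * Completing a greedy prefix *)

(** [greedy] constrains every step up to [#|bridges I|], while the construction only fixes the first
    [n]. The later steps may pick any maximizer. *)
Lemma greedy_extend (R : realType) (V : finType) (I : bridge_flow R V)
    (P : nat -> {set V * V}) (n : nat) :
  P 0 = finset.set0 ->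
  (forall k : nat, (k < n)%N -> exists2 x : V * V,
      x \in bridges I :\: P k /\
      (forall e, e \in bridges I :\: P k ->
        (bf_value I (e |: P k) <= bf_value I (x |: P k))%E)
      & P k.+1 = (x |: P k)%SET) ->
  exists2 S, greedy I S & S n = P n.
Proof.
move=> P0 PS.
pose best A x := (x \in bridges I :\: A) &&
  [forall e in bridges I :\: A, (bf_value I (e |: A)%SET <= bf_value I (x |: A)%SET)%E].
pose next A := if [pick x | best A x] is Some x then (x |: A)%SET else A.
pose S k := if (k <= n)%N then P k else iter (k - n) next (P n).
have step k : (#|S k| < #|bridges I|)%N -> exists2 x : V * V,
      x \in bridges I :\: S k /\
      (forall e, e \in bridges I :\: S k ->
        (bf_value I (e |: S k) <= bf_value I (x |: S k))%E)
      & S k.+1 = (x |: S k)%SET.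
  move=> ltk; case: (ltnP k n) => kn; first by rewrite /S kn (ltnW kn); apply: PS.
  have -> : S k.+1 = next (S k).
    (* For [k = n] the two branches of [S] agree, since [next] is then iterated 0 times. *)
    rewrite /S ltnNge kn /= subSn //=; case: leqP => // kn'.
    by have -> : k = n by [apply/eqP; rewrite eqn_leq kn']; rewrite subnn.
  have [x0 x0P] : exists x, x \in bridges I :\: S k.
    apply/set0Pn; apply: contraTneq ltk => /eqP; rewrite finset.setD_eq0.
    by move=> /subset_leq_card; rewrite -leqNgt.
  rewrite /next; case: pickP => [x /andP[xP /forall_inP xmax]|]; first by exists x.
  case: (arg_maxP (fun x => bf_value I (x |: S k)%SET) x0P) => x xP xmax /(_ x)/negP[].
  by apply/andP; split => //; apply/forall_inP => e; apply: xmax.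
exists S; last by rewrite /S leqnn.
split; first by rewrite /S.
(* Each step adds at most one bridge, so one is still available at every step [k < #|bridges I|]. *)
have Scard k : (k <= #|bridges I|)%N -> (#|S k| <= k)%N.
  elim: k => [|k IHk] kI; first by rewrite /S P0 cards0.
  have [|x _ ->] := step k; first by rewrite (leq_ltn_trans (IHk (ltnW kI))).
  rewrite cardsU1; have := IHk (ltnW kI).
  by case: (_ \notin _) => /= h; rewrite ?add1n ?ltnS // add0n ltnW.
by move=> k kI; apply: step; rewrite (leq_ltn_trans (Scard k (ltnW kI))).
Qed.

(** * The limit of the ratio *)

Lemma exists_ratio_gt (R : realType) (rho : R) :
  rho < 2 * expR 1 ^+ 2 / (expR 1 ^+ 2 - 1) ->
  exists n : nat, rho * (1 - (1 - n.+2%:R^-1) ^+ (2 * n.+2)) < 2.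
Proof.
set x := expR (- 2%:R) : R.
have x0 : 0 < x by exact: expR_gt0.
have x1 : x < 1 by rewrite expR_lt1 oppr_lt0.
have -> : expR 1 ^+ 2 = x^-1 :> R by rewrite -expRM_natl mulr1 /x expRN invrK.
(* With [x] equal to e^-2, the bound of the theorem is 2 / (1 - x). *)
have -> : 2 * x^-1 / (x^-1 - 1) = 2 / (1 - x) by field; lra.
rewrite ltr_pdivlMr ?subr_gt0 // => hrho.
have [rho0|rho0] := leP rho 0.
  exists 0%N; apply: (@le_lt_trans _ _ 0) => //; rewrite mulr_le0_ge0 //.
  by rewrite subr_ge0 exprn_ile1 //; lra.
(* Chosen so that the error term 2 rho x / (n + 1) is below the slack 2 - rho (1 - x). *)
pose n := Num.truncn (2 * rho * x / (2 - rho * (1 - x))); exists n.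
have nP : 2 * rho * x / (2 - rho * (1 - x)) < n.+1%:R by exact: truncnS_gt.
have n0 : 0 < n.+1%:R :> R by [].
have qE : 1 - n.+2%:R^-1 = (1 + n.+1%:R^-1)^-1 :> R.
  by rewrite -(@natr1 R n.+1); field; rewrite ?gt_eqF //; lra.
(* The inequality 1 + y <= exp y is used twice: for y = 1/(n+1), bounding 1 / (1 - 1/(n+2)) from
   above, and for y = -2/(n+1), the excess of the exponent -2 (n+2)/(n+1) over -2. *)
have q_ge : x * (1 - 2 / n.+1%:R) <= (1 - n.+2%:R^-1) ^+ (2 * n.+2).
  apply: (@le_trans _ _ (expR (- n.+1%:R^-1) ^+ (2 * n.+2))).
    rewrite -expRM_natl.
    have -> : (2 * n.+2)%:R * - n.+1%:R^-1 = - 2 + - (2 / n.+1%:R) :> R.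
      by rewrite natrM -(@natr1 R n.+1); field; lra.
    by rewrite expRD ler_pM2l // expR_ge1Dx.
  apply: lerXn2r; rewrite ?nnegrE ?expR_ge0 //.
    by rewrite qE invr_ge0 addr_ge0 // invr_ge0 ltW.
  rewrite qE expRN lef_pV2 ?posrE ?expR_gt0 ?expR_ge1Dx //.
rewrite ltr_pdivrMr ?subr_gt0 // in nP.
apply: (@le_lt_trans _ _ (rho * (1 - x * (1 - 2 / n.+1%:R)))).
  by rewrite ler_pM2l // lerD2l lerN2.
have -> : rho * (1 - x * (1 - 2 / n.+1%:R)) =
    rho * (1 - x) + 2 * rho * x / n.+1%:R by field; lra.
by rewrite -ltrBrDl ltr_pdivrMr // [ltRHS]mulrC.
Qed.

(** * The network *)

Lemma big_option (R : realType) (T : finType) (F : option T -> R) :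
  \sum_o F o = F None + \sum_x F (Some x).
Proof.
rewrite (bigD1 None)//=; congr (_ + _).
rewrite (reindex_omap (@Some T) id) => [|[]//]; apply: eq_bigl => x.
by rewrite eqxx.
Qed.

(* The boolean tells whether the vertex is in U.  Besides [s] and [t] there are
   [va i], [vc j] in U and [vb i], [vd j] in W, called a_i, c_j, b_i, d_j above. *)
Definition vertex (m : nat) := (bool * option ('I_m + 'I_(2 * m)))%type.

Local Notation src := (true, None).
Local Notation snk := (false, None).
Local Notation va i := (true, Some (inl i)).
Local Notation vc j := (true, Some (inr j)).
Local Notation vb i := (false, Some (inl i)).
Local Notation vd j := (false, Some (inr j)).

Section Network.
Variables (R : realType) (m : nat).

Definition decay : R := 1 - m%:R^-1.

(** Capacity 0 encodes a missing edge, so this function determines the whole graph. *)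
Definition network_cap (e : vertex m * vertex m) : R :=
  match e with
  | (src, va _) | (va _, snk) | (src, vb _) | (vb _, snk) => 1
  | (va _, vc j) | (vd j, vb _) => decay ^+ j / m%:R
  | (vc j, vd j') => if j == j' then decay ^+ j else 0
  | _ => 0
  end.
Local Notation cap := network_cap.

Definition network_edges : {set vertex m * vertex m} :=
  [set e | network_cap e != 0]%SET.

Lemma sum_vertex (F : vertex m -> R) :
  \sum_v F v = F src + \sum_i F (va i) + \sum_j F (vc j) +
    (F snk + \sum_i F (vb i) + \sum_j F (vd j)).
Proof.
rewrite (eq_bigr (fun v => F (v.1, v.2))) => [|[]//].
rewrite -(pair_bigA _ (fun b o => F (b, o))) big_bool/=.
by rewrite !big_option/= !big_sumType/= !addrA.
Qed.

(** Splits a sum over all vertex pairs into the seven families of edges, so that cut capacities can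
    be computed family by family. *)
Lemma sum_network_edges (G : vertex m * vertex m -> R) :
  (forall e, e \notin network_edges -> G e = 0) ->
  \sum_e G e =
    \sum_i G (src, va i) + \sum_i G (src, vb i) +
    \sum_i G (va i, snk) + \sum_i G (vb i, snk) +
    \sum_j G (vc j, vd j) +
    \sum_j \sum_i G (va i, vc j) + \sum_j \sum_i G (vd j, vb i).
Proof.
move=> G0; have {}G0 e : network_cap e = 0 -> G e = 0.
  by move=> e0; rewrite G0 // inE e0 eqxx.
rewrite (eq_bigr (fun e => G (e.1, e.2))) => [|[]//].
rewrite -(pair_bigA _ (fun x y => G (x, y))) sum_vertex/=.
have -> : \sum_y G (src, y) = \sum_i G (src, va i) + \sum_i G (src, vb i).
  rewrite sum_vertex !G0 // [X in _ + X + _]big1 ?[X in _ + (_ + X)]big1;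
    try by move=> *; apply: G0.
  by rewrite !add0r !addr0.
have -> : \sum_y G (snk, y) = 0.
  by rewrite big1 // => -[[] [[]|]] *; apply: G0.
have -> : \sum_i \sum_y G (va i, y) =
    \sum_i G (va i, snk) + \sum_j \sum_i G (va i, vc j).
  rewrite [X in _ + X]exchange_big -big_split/=; apply: eq_bigr => i _.
  rewrite sum_vertex (G0 (va i, src)) //.
  rewrite big1 ?[X in _ + (_ + X + _)]big1 ?[X in _ + (_ + X)]big1;
    try by move=> *; apply: G0.
  by rewrite !add0r !addr0 addrC.
have -> : \sum_i \sum_y G (vb i, y) = \sum_i G (vb i, snk).
  apply: eq_bigr => i _; rewrite sum_vertex (G0 (vb i, src)) //.
  rewrite big1 ?[X in _ + X + _]big1 ?[X in _ + (_ + X + _)]big1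
    ?[X in _ + (_ + X)]big1;
    try by move=> *; apply: G0.
  by rewrite !add0r !addr0.
have -> : \sum_j \sum_y G (vc j, y) = \sum_j G (vc j, vd j).
  apply: eq_bigr => j _; rewrite sum_vertex (G0 (vc j, src)) //.
  rewrite (G0 (vc j, snk)) // [X in _ + (_ + X)](bigD1 j)//=.
  rewrite big1 ?[X in _ + X + _]big1 ?[X in _ + (_ + X + _)]big1
    ?[X in _ + (_ + (_ + X))]big1; try by move=> *; apply: G0.
    by rewrite !add0r !addr0.
  by move=> j' /negPf jj'; apply: G0; rewrite /= eq_sym jj'.
have -> : \sum_j \sum_y G (vd j, y) = \sum_j \sum_i G (vd j, vb i).
  apply: eq_bigr => j _; rewrite sum_vertex (G0 (vd j, src)) //.
  rewrite (G0 (vd j, snk)) //.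
  rewrite big1 ?[X in _ + X + _]big1 ?[X in _ + (_ + X)]big1;
    try by move=> *; apply: G0.
  by rewrite !add0r !addr0.
ring.
Qed.
Lemma decay_ge0 : 0 <= decay.
Proof.
rewrite subr_ge0; case: m => [|n]; first by rewrite invr0.
by rewrite invf_le1 // ler1n.
Qed.

Lemma decay_le1 : decay <= 1.
Proof. by rewrite lerBlDr lerDl invr_ge0. Qed.

Lemma decay_gt0 : (1 < m)%N -> 0 < decay.
Proof. by move=> m1; rewrite subr_gt0 invf_lt1 ?ltr1n // ltr0n ltnW. Qed.

Lemma network_cap_ge0 e : 0 <= cap e.
Proof.
have q0 j : 0 <= decay ^+ j by rewrite exprn_ge0 ?decay_ge0.
have qm0 j : 0 <= decay ^+ j / m%:R by rewrite divr_ge0.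
by case: e => -[[] [[i|j]|]] [[] [[i'|j']|]] //=; case: eqP.
Qed.

Lemma network_cap_ereal_ge0 e : e \in network_edges -> (0 <= (EFin \o cap) e)%E.
Proof. by rewrite lee_fin network_cap_ge0. Qed.

Lemma source_in_left : (src : vertex m) \in [set v : vertex m | v.1]%SET.
Proof. by rewrite inE. Qed.

Lemma sink_in_right : (snk : vertex m) \in ~: [set v : vertex m | v.1]%SET.
Proof. by rewrite !inE. Qed.

Lemma network_no_back e : e \in network_edges ->
  ~~ ((e.1 \in ~: [set v : vertex m | v.1]%SET) &&
     (e.2 \in [set v : vertex m | v.1]%SET)).
Proof.
rewrite !inE; apply: contraNN.
by case: e => -[[] [[i|j]|]] [[] [[i'|j']|]] //=; rewrite eqxx.
Qed.

Definition network : bridge_flow R (vertex m) :=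
  BridgeFlow network_cap_ereal_ge0 source_in_left sink_in_right network_no_back.

Lemma in_bridges e : (e \in bridges network) = [&& cap e != 0, e.1.1 & ~~ e.2.1].
Proof. by rewrite !inE. Qed.

Lemma in_remaining S e :
  (e \in bf_edges network :\: (bridges network :\: S)) =
  (cap e != 0) && (e.1.1 && ~~ e.2.1 ==> (e \in S)).
Proof.
rewrite !inE/=; case: (cap e != 0); case: (e.1.1 && ~~ e.2.1); case: (e \in S) => //=.
Qed.

(** * Upper bounds from cuts, lower bounds from flows *)

(** The seven sums are the edge families crossing the cut [X]; only the three families of bridges
    depend on [S]. *)
Lemma bf_value_le_cut (S : {set vertex m * vertex m}) (X : pred (vertex m)) :
  X src -> ~~ X snk ->
  (bf_value network S <= (
    \sum_i (if ~~ X (va i) then 1 else 0) +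
    \sum_i (if ((src, vb i) \in S) && ~~ X (vb i) then 1 else 0) +
    \sum_i (if ((va i, snk) \in S) && X (va i) then 1 else 0) +
    \sum_i (if X (vb i) then 1 else 0) +
    \sum_j (if [&& (vc j, vd j) \in S, X (vc j) & ~~ X (vd j)] then decay ^+ j else 0) +
    \sum_j \sum_i (if X (va i) && ~~ X (vc j) then decay ^+ j / m%:R else 0) +
    \sum_j \sum_i (if X (vd j) && ~~ X (vb i) then decay ^+ j / m%:R else 0))%:E)%E.
Proof.
move=> Xs Xt.
have sX : src \in [set v | X v]%SET by rewrite inE.
have tX : snk \notin [set v | X v]%SET by rewrite inE.
apply: le_trans (max_flow_le_cut _ _ sX tX) _; rewrite lee_fin.
rewrite (eq_bigl (fun e => (e \in bf_edges network :\: (bridges network :\: S)) &&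
    (X e.1 && ~~ X e.2))); last by move=> e; rewrite !inE.
rewrite big_mkcond/= (eq_bigr (fun e =>
    if (e.1.1 && ~~ e.2.1 ==> (e \in S)) && (X e.1 && ~~ X e.2)
    then cap e else 0)); last first.
  by move=> e _; rewrite in_remaining; case: eqP => [->|//]; case: ifP.
rewrite sum_network_edges => [|e]; last by rewrite inE negbK => /eqP ->; case: ifP.
rewrite /= Xs (negPf Xt) /=.
by rewrite !lerD //; apply: ler_sum => i _; rewrite ?eqxx ?andbT.
Qed.

(** Sends [y] along every direct path and [w j] through [(vc j, vd j)], spread evenly over all
    [va i] before it and all [vb i] after it. *)
Definition network_flow (y : R) (w : 'I_(2 * m) -> R) (e : vertex m * vertex m) : R :=
  match e with
  | (src, va _) | (vb _, snk) => y + \sum_j w j / m%:R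
  | (va _, snk) | (src, vb _) => y
  | (va _, vc j) | (vd j, vb _) => w j / m%:R
  | (vc j, vd j') => if j == j' then w j else 0
  | _ => 0
  end.

Lemma bf_value_ge_flow (S : {set vertex m * vertex m}) (y : R)
    (w : 'I_(2 * m) -> R) : (0 < m)%N ->
  0 <= y -> (forall j, 0 <= w j <= decay ^+ j) -> y + \sum_j w j / m%:R <= 1 ->
  (forall i, (va i, snk) \notin S -> y = 0) ->
  (forall i, (src, vb i) \notin S -> y = 0) ->
  (forall j, (vc j, vd j) \notin S -> w j = 0) ->
  (((2 * m)%:R * y + \sum_j w j)%:E <= bf_value network S)%E.
Proof.
move=> m0 y0 w_bd total Sa Sb Sc; pose phi := network_flow y w.
have m0' : m%:R != 0 :> R by rewrite pnatr_eq0 -lt0n.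
have w0 j : 0 <= w j by have /andP[] := w_bd j.
have w1 j : w j <= decay ^+ j by have /andP[] := w_bd j.
have wm0 j : 0 <= w j / m%:R by rewrite divr_ge0.
have wm1 j : w j / m%:R <= decay ^+ j / m%:R by rewrite ler_wpM2r ?invr_ge0.
have sw0 : 0 <= \sum_j w j / m%:R by exact: sumr_ge0.
have phi_bd e : 0 <= phi e <= cap e.
  case: e => -[[] [[i|j]|]] [[] [[i'|j']|]] //=;
    rewrite ?lexx ?w0 ?w1 ?wm0 ?wm1 ?total ?addr_ge0 //.
  - by rewrite y0 (le_trans _ total) // lerDl.
  - by case: (j == j'); rewrite ?w0 ?w1 ?lexx.
  - by rewrite y0 (le_trans _ total) // lerDl.
set F := bf_edges network :\: (bridges network :\: S).
(* Since [phi] vanishes on missing edges and unselected bridges, sums over [F] become sums over all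
   vertex pairs. *)
have phi_out e : e \notin F -> phi e = 0.
  rewrite in_remaining negb_and negbK => /orP[/eqP e0|].
    by apply/eqP; rewrite eq_le -{1}e0 andbC; exact: phi_bd.
  rewrite negb_imply => /andP[].
  case: e => -[[] [[i|j]|]] [[] [[i'|j']|]] //= _.
  - exact: Sa.
  - by case: eqP => [->|//]; exact: Sc.
  - exact: Sb.
have sumF (P : pred _) : \sum_(e in F | P e) phi e = \sum_(e | P e) phi e.
  rewrite big_mkcond [RHS]big_mkcond/=; apply: eq_bigr => e _.
  by case: (P e); rewrite ?andbF ?andbT//; case: ifPn => // /phi_out.
have out v : \sum_(e in F | e.1 == v) phi e = \sum_z phi (v, z).
  rewrite sumF; rewrite (reindex_onto (pair v) snd) => [|[x z] /= /eqP <- //].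
  by apply: eq_bigl => z; rewrite /= !eqxx.
have into v : \sum_(e in F | e.2 == v) phi e = \sum_z phi (z, v).
  rewrite sumF; rewrite (reindex_onto (pair^~ v) fst) => [|[x z] /= /eqP <- //].
  by apply: eq_bigl => z; rewrite /= !eqxx.
apply: ereal_sup_ubound; exists phi => /=.
  split=> [e _|v vs vt]; first by rewrite lee_fin; apply/andP; exact: phi_bd.
  rewrite into out !sum_vertex /phi.
  (* Conservation at [va i], [vc j], [vb i] and [vd j], in this order; at [vc j] and [vd j] the m
     shares [w j / m%:R] add up to [w j]. *)
  case: v vs vt => -[] [[i|j]|] //= _ _; rewrite ?big1_eq ?addr0 ?add0r.
  - by rewrite addrC.
  - rewrite sumr_const card_ord -(mulr_natr (_ / _)) divfK //.
    by rewrite (bigD1 j)//= eqxx big1 ?addr0// => j'; rewrite eq_sym => /negPf ->.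
  - by rewrite addrC.
  - rewrite sumr_const card_ord -(mulr_natr (_ / _)) divfK //.
    by rewrite (bigD1 j)//= eqxx big1 ?addr0// => j' /negPf ->.
rewrite /flow_value into out !sum_vertex /phi/= ?big1_eq ?addr0 ?add0r ?subr0.
by rewrite !sumr_const card_ord -mulr_suml; congr (_%:E); field.
Qed.

(** * The greedy chain and the gains of single bridges *)

Definition chain (n : nat) : {set vertex m * vertex m} :=
  [set e : vertex m * vertex m |
    if e is (vc j, vd j') then (j == j') && (j < n)%N else false]%SET.

Lemma chain0 : chain 0 = finset.set0.
Proof.
by apply/finset.setP => -[[[] [[i|j]|]] [[] [[i'|j']|]]]; rewrite !inE //= andbF.
Qed.

Lemma chainS n (ltn : (n < 2 * m)%N) :
  chain n.+1 = ((vc (Ordinal ltn), vd (Ordinal ltn)) |: chain n)%SET.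
Proof.
apply/finset.setP => -[[[] [[i|j]|]] [[] [[i'|j']|]]]; rewrite !inE //=;
  try by apply/esym; rewrite orbF; apply/negbTE/eqP.
apply/idP/orP => [/andP[/eqP <-]|[/eqP[-> ->]|/andP[-> /ltnW]//]];
  last by rewrite eqxx leqnn.
rewrite eqxx ltnS leq_eqVlt => /orP[/eqP jn|->]; last by right.
by left; have -> : j = Ordinal ltn by exact: val_inj.
Qed.

Definition partial_sum (n : nat) : R := \sum_(j < n) decay ^+ j.

(** This form of the recursion matches the cuts against direct bridges: one edge of capacity 1, plus
    side edges of total capacity [decay * partial_sum n]. *)
Lemma partial_sumS n : partial_sum n.+1 = 1 + decay * partial_sum n.
Proof.
rewrite /partial_sum big_ord_recl expr0 mulr_sumr; congr (_ + _).
by apply: eq_bigr => i _; rewrite -exprS.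
Qed.

Lemma partial_sumE n : (0 < m)%N -> partial_sum n = m%:R * (1 - decay ^+ n).
Proof.
move=> m0; have m0' : m%:R != 0 :> R by rewrite pnatr_eq0 -lt0n.
have -> : 1 - decay ^+ n = m%:R^-1 * partial_sum n.
  by rewrite -opprB subrX1 -mulNr opprB /decay opprB addrC subrK.
by rewrite mulVKf.
Qed.

Lemma sum_lt n : (n <= 2 * m)%N ->
  \sum_(j < 2 * m) (if (j < n)%N then decay ^+ j else 0) = partial_sum n.
Proof.
move=> n2m.
by rewrite -big_mkcond /partial_sum (big_ord_widen _ (fun j => decay ^+ j) n2m).
Qed.

Lemma bf_value_chain n : (0 < m)%N -> (n <= 2 * m)%N ->
  bf_value network (chain n) = (partial_sum n)%:E.
Proof.
move=> m0 n2m; apply/eqP; rewrite eq_le; apply/andP; split.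
  (* The cut [fst] is U itself, crossed only by the selected bridges. *)
  apply: le_trans (bf_value_le_cut (X := fst) _ _ _) _ => //.
  rewrite lee_fin -(sum_lt n2m) /= ?big1_eq ?addr0 ?add0r.
  rewrite big1 ?add0r => [|i _]; last by rewrite inE.
  rewrite big1 ?add0r => [|i _]; last by rewrite inE.
  by apply: ler_sum => j _; rewrite inE eqxx/= andbT.
apply: le_trans (bf_value_ge_flow (y := 0)
  (w := fun j => if (j < n)%N then decay ^+ j else 0) m0 _ _ _ _ _ _) => //.
- by rewrite mulr0 add0r sum_lt.
- by move=> j; case: ifP; rewrite ?lexx ?exprn_ge0 ?decay_ge0.
(* Each edge [(src, va i)] carries [partial_sum n / m%:R], which is 1 - q^n. *)
- rewrite add0r -mulr_suml sum_lt // partial_sumE // mulrC mulKf ?pnatr_eq0 -?lt0n //.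
  by rewrite gerBl exprn_ge0 ?decay_ge0.
- by move=> j; rewrite inE eqxx /= => /negPf ->.
Qed.

(** The cut U again: the new bridge adds at most q^j <= q^n. *)
Lemma bf_value_chain_vc n (j : 'I_(2 * m)) : (n <= j)%N ->
  (bf_value network ((vc j, vd j) |: chain n)%SET <= (partial_sum n.+1)%:E)%E.
Proof.
move=> nj; apply: le_trans (bf_value_le_cut (X := fst) _ _ _) _ => //.
rewrite lee_fin /= ?big1_eq ?addr0 ?add0r.
rewrite big1 ?add0r => [|i _]; last by rewrite !inE.
rewrite big1 ?add0r => [|i _]; last by rewrite !inE.
have n2m : (n <= 2 * m)%N by rewrite ltnW // (leq_ltn_trans nj).
apply: (@le_trans _ _ (partial_sum n + decay ^+ j)).
  rewrite -(sum_lt n2m) -[X in _ + X](big_pred1_eq +%R j (fun j => decay ^+ j)).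
  rewrite [X in _ + X]big_mkcond -big_split; apply: ler_sum => k _.
  have -> : ((vc k, vd k) \in (vc j, vd j) |: chain n)%SET = (k == j) || (k < n)%N.
    rewrite !inE eqxx; congr (_ || _).
    by apply/eqP/eqP => [[]|->].
  have := exprn_ge0 k decay_ge0.
  by case: (k == j); case: (k < n)%N => /= h; rewrite ?addr0 ?add0r ?lerDl.
rewrite {2}/partial_sum big_ord_recr lerD2l.
by rewrite ler_wiXn2l ?decay_ge0 ?decay_le1.
Qed.

(** Omitting one of the m side edges of each chosen [j] leaves the fraction (m-1)/m = q of q^j. *)
Lemma sum_side_edges n (i0 : 'I_m) : (n <= 2 * m)%N ->
  \sum_(j < 2 * m) \sum_(i < m)
    (if (j < n)%N && (i != i0) then decay ^+ j / m%:R else 0) =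
  decay * partial_sum n.
Proof.
move=> n2m; rewrite -(sum_lt n2m) mulr_sumr; apply: eq_bigr => j _.
case: (j < n)%N => /=; last by rewrite big1_eq mulr0.
have m0 : (0 < m)%N by case: m i0 => [[]|].
rewrite -big_mkcond sumr_const cardC1 card_ord -(mulr_natr (_ / _)) -subn1 natrB //.
by rewrite /decay; field; rewrite pnatr_eq0 -lt0n.
Qed.

Lemma bf_value_chain_va n (i : 'I_m) : (n <= 2 * m)%N ->
  (bf_value network ((va i, snk) |: chain n)%SET <= (partial_sum n.+1)%:E)%E.
Proof.
(* The cut consists of (src, va i) and of the edges from the other [va i'] to the
   chosen [vc j]. *)
move=> n2m; apply: le_trans (bf_value_le_cut (X := fun v => match v with
  | src => true | va i' => i' != i | vc j => (n <= j)%N | _ => false end) _ _ _) _ => //.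
rewrite lee_fin /= ?big1_eq ?addr0.
rewrite [X in _ + X + _ + _ + _]big1 ?addr0 => [|k _]; last by rewrite !inE.
rewrite [X in _ + X + _ + _]big1 ?addr0 => [|k _]; last first.
  rewrite !inE orbF; case: (eqVneq k i) => ki; first by rewrite andbF.
  by rewrite andbT; case: eqP => // -[] /eqP; rewrite (negPf ki).
rewrite [X in _ + X + _]big1 ?addr0 => [|k _]; last first.
  by rewrite !inE eqxx /= andbT (leqNgt n) andbN.
rewrite partial_sumS -(sum_side_edges i n2m) lerD //.
  under eq_bigr do rewrite negbK.
  by rewrite -big_mkcond big_pred1_eq.
by under eq_bigr do under eq_bigr do rewrite -ltnNge andbC.
Qed.

(** The mirrored cut: [(vb i, snk)] and the edges from the chosen [vd j] to the other [vb i']. *)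
Lemma bf_value_chain_vb n (i : 'I_m) : (n <= 2 * m)%N ->
  (bf_value network ((src, vb i) |: chain n)%SET <= (partial_sum n.+1)%:E)%E.
Proof.
move=> n2m; apply: le_trans (bf_value_le_cut (X := fun v => match v with
  | snk => false | vb i' => i' == i | vd j => (j < n)%N | _ => true end) _ _ _) _ => //.
rewrite lee_fin /= ?big1_eq ?addr0 ?add0r.
rewrite big1 ?add0r => [|k _]; last first.
  rewrite !inE orbF; case: (eqVneq k i) => ki; first by rewrite andbF.
  by rewrite andbT; case: eqP => // -[] /eqP; rewrite (negPf ki).
rewrite big1 ?add0r => [|k _]; last by rewrite !inE.
rewrite [X in _ + X + _]big1 ?addr0 => [|k _]; last first.
  by rewrite !inE eqxx /= andbN.
rewrite partial_sumS -(sum_side_edges i n2m) lerD //.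
by rewrite -big_mkcond big_pred1_eq.
Qed.

(** * The competing solution *)

Definition direct : {set vertex m * vertex m} :=
  [set (va i, snk) | i : 'I_m]%SET :|: [set (src, vb i) | i : 'I_m]%SET.

Lemma card_direct : #|direct| = (2 * m)%N.
Proof.
rewrite cardsU disjoint_setI0.
  rewrite cards0 subn0 !card_imset ?card_ord ?mul2n ?addnn //.
  - by move=> i j [].
  - by move=> i j [].
rewrite disjoint_subset; apply/fintype.subsetP => _ /imsetP[i _ ->]; rewrite inE.
by apply/imsetP => -[].
Qed.

Lemma direct_sub_bridges : direct \subset bridges network.
Proof.
apply/fintype.subsetP => e; rewrite in_bridges.
by case/finset.setUP => /imsetP[i _ ->]; rewrite /= oner_eq0.
Qed.

Lemma bf_value_direct : (0 < m)%N -> ((2 * m)%:R%:E <= bf_value network direct)%E.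
Proof.
move=> m0; apply: le_trans (bf_value_ge_flow (y := 1)
  (w := fun _ => 0) m0 _ _ _ _ _ _) => //.
- by rewrite mulr1 big1_eq addr0.
- by move=> j; rewrite lexx exprn_ge0 ?decay_ge0.
- by rewrite mul0r big1_eq addr0.
- by move=> i; rewrite inE imset_f.
- by move=> i; rewrite inE orbC imset_f.
Qed.

Lemma chain_greedy n : (1 < m)%N -> (n < 2 * m)%N ->
  exists2 x, x \in bridges network :\: chain n /\
      (forall e, e \in bridges network :\: chain n ->
        (bf_value network (e |: chain n) <= bf_value network (x |: chain n))%E)
      & chain n.+1 = (x |: chain n)%SET.
Proof.
move=> m1 n2m; have m0 := ltnW m1.
exists (vc (Ordinal n2m), vd (Ordinal n2m)); last exact: chainS.
split.
  (* The assumption [1 < m] makes q positive, so this pair is indeed an edge. *)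
  by rewrite finset.inE in_bridges inE /= eqxx ltnn expf_neq0 // gt_eqF ?decay_gt0.
move=> e; rewrite finset.in_setD in_bridges -(chainS n2m) bf_value_chain //.
(* Three kinds of bridges remain, each with its own cut bound [partial_sum n.+1]. *)
case: e => -[[] [[i|j]|]] [[] [[i'|j']|]]; rewrite /= ?eqxx ?andbF // => /and3P[+ + _].
- by move=> _ _; apply: bf_value_chain_va; exact: ltnW.
- rewrite /= inE; case: (eqVneq j j') => [<-|]; rewrite ?eqxx //.
  by rewrite -leqNgt => nj _; exact: bf_value_chain_vc.
- by move=> _ _; apply: bf_value_chain_vb; exact: ltnW.
Qed.

End Network.

(** * Comparison after 2m steps *)

Theorem theorem20 (R : realType) (rho : R)
  (hrho : rho < 2 * expR 1 ^+ 2 / (expR 1 ^+ 2 - 1)) :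
  exists (V : finType) (I : bridge_flow R V) (S : nat -> {set V * V}),
    greedy I S /\ ~ competitive I S rho.
Proof.
have [n hn] := exists_ratio_gt hrho; set m := n.+2 in hn.
have m0 : (0 < m)%N by [].
have [S gS SE] := greedy_extend (chain0 m) (fun k => @chain_greedy R m k isT).
exists (vertex m), (network R m), S; split; first exact: gS.
move=> /(_ (2 * m)%N).
have le_card : (2 * m <= #|bridges (network R m)|)%N.
  by have := subset_leq_card (direct_sub_bridges R m); rewrite card_direct.
rewrite le_card muln_gt0 => /(_ isT); rewrite SE bf_value_chain //.
apply/negP; rewrite -ltNge.
have ps0 : 0 < partial_sum R m (2 * m).
  rewrite /partial_sum big_ord_recl expr0 ltr_pwDl // sumr_ge0 // => i _.
  by rewrite exprn_ge0 ?decay_ge0.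
have opt : ((2 * m)%:R%:E <= bf_opt (network R m) (2 * m))%E.
  apply: le_trans (bf_value_direct R m0) _.
  by apply: le_bigmax_cond; rewrite direct_sub_bridges card_direct eqxx.
(* The greedy value is positive, so this is a genuine division and not the convention for 0.
   Cancelling m then leaves [hn]. *)
rewrite inver (gt_eqF ps0) lte_pdivlMr // -EFinM; apply: lt_le_trans opt.
rewrite lte_fin partial_sumE // mulrCA natrM mulrC ltr_pM2r ?ltr0n //.
Qed.
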